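(* Let $G=(V_1,E_1)$ be a connected graph with $|V_1|\ge 2$ and $H=(V_2,E_2)$ an arbitrary graph with $|V_2|\ge 1$. Let $A_H$ be the adjacency matrix of $H$. If \[ -2-\psi_{H*}^{-1}(\mathrm{QEC}(G))\notin \mathrm{ev}(A_H), \] then \[ \mathrm{QEC}(G\odot H)=\max\{\psi_{H*}^{-1}(\mathrm{QEC}(G)),\ \gamma_3\}, \] where \[ \gamma_3=\max\bigl(\lambda(\mathcal{S})\cap\{\lambda\in\mathbb{R}\,;\,\det(A_H+2I+\lambda I)=0\}\bigr), \] with the convention $\gamma_3=-\infty$ if this set is empty.
   Context: All graphs are finite, simple and undirected. For a connected graph $G=(V,E)$ with $|V|\ge2$ and distance matrix $D=[d(x,y)]_{x,y\in V}$ (graph distance), $\mathrm{QEC}(G)=\max\{\langle f,Df\rangle\,;\, f\in C(V),\ \langle f,f\rangle=1,\ \langle \mathbf{1},f\rangle=0\}$, where $C(V)$ is the space of real column vectors indexed by $V$ with the canonical inner product and $\mathbf{1}$ is the all-one vector. Corona: for graphs $G=(V_1,E_1)$, $H=(V_2,E_2)$ with $V_1\cap V_2=\emptyset$, $G\odot H$ is obtained from $G$ and $|V_1|$ disjoint copies of $H$ (one for each vertex of $G$) by joining each vertex of $G$ to every vertex of its copy of $H$. The set $\lambda(\mathcal{S})$: let $V$ be the vertex set and $D$ the distance matrix of $G\odot H$. $\mathcal{S}$ is the set of all $(f,\lambda,\mu)\in C(V)\times\mathbb{R}\times\mathbb{R}$ with $(D-\lambda I)f=\frac{\mu}{2}\mathbf{1}$,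 $\langle\mathbf{1},f\rangle=0$, $\langle f,f\rangle=1$; and $\lambda(\mathcal{S})$ is the set of $\lambda\in\mathbb{R}$ appearing in some $(f,\lambda,\mu)\in\mathcal{S}$. Functions associated with $H$: let $A_H$ be the adjacency matrix of $H$, $\mathrm{ev}(A_H)$ the set of its distinct eigenvalues, $E_\alpha$ the orthogonal projection onto the eigenspace of $\alpha$ ($E_\alpha=0$ if $\alpha\notin\mathrm{ev}(A_H)$), and $\mathrm{ev}_{\mathrm{M}}(A_H)=\{\alpha\in\mathrm{ev}(A_H)\,;\,E_\alpha\mathbf{1}\ne0\}$ the set of main eigenvalues. The function $\omega_H$ is the maximal real analytic extension of $\lambda\mapsto 1+\lambda\langle\mathbf{1},(A_H+2+\lambda)^{-1}\mathbf{1}\rangle$ (scalars stand for multiples of $I$), i.e. \[ \omega_H(\lambda)=1+\|E_{-2}\mathbf{1}\|^2+\sum_{\alpha\in\mathrm{ev}_{\mathrm{M}}(A_H)\setminus\{-2\}}\frac{\lambda}{\alpha+2+\lambda}\|E_\alpha\mathbf{1}\|^2 \] on $\mathbb{R}\setminus\{-\alpha-2\,;\,\alpha\in\mathrm{ev}_{\mathrm{M}}(A_H)\setminus\{-2\}\}$. It has at least one real zero; $\lambda_*$ denotes its largest zero. The function $\psi_H$ is the unique real analytic function on $\mathbb{R}\setminus\{\omega_H=0\}$ with $\psi_H(\lambda)=\lambda/\omega_H(\lambda)$ (so $\psi_H(-\alpha-2)=0$ for $\alpha\in\mathrm{ev}_{\mathrm{M}}(A_H)\setminus\{-2\}$). The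 restriction $\psi_{H*}=\psi_H\restriction_{(\lambda_*,+\infty)}$ is a strictly increasing bijection onto $\mathbb{R}$, and $\psi_{H*}^{-1}:\mathbb{R}\to(\lambda_*,+\infty)$ is its inverse. *)

(* Defs.v *)
From HB Require Import structures.
From mathcomp Require Import all_boot all_order all_algebra.
From mathcomp Require Import boolp classical_sets fsbigop reals constructive_ereal.

Set Implicit Arguments.
Unset Strict Implicit.
Unset Printing Implicit Defensive.

Import Order.TTheory GRing.Theory Num.Theory.
Local Open Scope classical_set_scope.
Local Open Scope ring_scope.

Record sgraph (V : finType) := SGraph {
  edge :> rel V;
  edge_sym : symmetric edge;
  edge_irrefl : irreflexive edge }.

Definition graph_connected (V : finType) (G : sgraph V) : Prop :=
  forall x y : V, connect G x y.

(* The least length of a walk from x to y; in a connected graph it is always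
   smaller than #|V|, otherwise #|V| is returned when there is no walk. *)
Definition dist (V : finType) (G : sgraph V) (x y : V) : nat :=
  find (fun k => [exists p : k.-tuple V, path G x p && (last x p == y)])
       (iota 0 #|V|).

Section Corona.
Variables (V1 V2 : finType) (G : sgraph V1) (H : sgraph V2).

(* inl x is the vertex x of G, inr (x, a) the vertex a of the x-th copy of H *)
Definition corona_edge (u v : V1 + V1 * V2) : bool :=
  match u, v with
  | inl x, inl y => G x y
  | inl x, inr (y, _) => x == y
  | inr (x, _), inl y => x == y
  | inr (x, a), inr (y, b) => (x == y) && H a b
  end.

Lemma corona_sym : symmetric corona_edge.
Proof.
by case=> [x|[x a]] [y|[y b]] /=; rewrite 1?edge_sym 1?eq_sym.
Qed.

Lemma corona_irrefl : irreflexive corona_edge.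
Proof. by case=> [x|[x a]] /=; rewrite edge_irrefl ?andbF. Qed.

Definition corona : sgraph (V1 + V1 * V2)%type :=
  SGraph corona_sym corona_irrefl.

End Corona.

(* C(V) is 'cV[R]_#|V|, coordinates being listed along enum_val. *)
Section Matrices.
Variables (R : realType) (V : finType) (G : sgraph V).

Definition adjmx : 'M[R]_#|V| :=
  \matrix_(i, j) (G (enum_val i) (enum_val j))%:R.

Definition distmx : 'M[R]_#|V| :=
  \matrix_(i, j) (dist G (enum_val i) (enum_val j))%:R.

End Matrices.

Section Vectors.
Variable R : realType.

Definition dotv n (u v : 'cV[R]_n) : R := \sum_(i < n) u i 0 * v i 0.

Definition ones n : 'cV[R]_n := const_mx 1.

(* Meaningful only for sets having a greatest element. *)
Definition maximum (A : set R) : R := xget 0 (A `&` ubound A).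

Lemma maximumE (A : set R) (m : R) : A m -> ubound A m -> maximum A = m.
Proof.
move=> Am ubm; apply: xget_unique; first by [].
by move=> y [Ay uby]; apply/eqP; rewrite eq_le ubm ?uby.
Qed.

Definition maximum_ninfty (A : set R) : \bar R :=
  if `[< A = set0 >] then -oo%E else (maximum A)%:E.

End Vectors.

Definition QEC (R : realType) (V : finType) (G : sgraph V) : R :=
  maximum [set dotv f (distmx R G *m f) | f in
             [set f : 'cV[R]_#|V| | dotv f f = 1 /\ dotv (ones R #|V|) f = 0]].

Definition stationary (R : realType) (V : finType) (G : sgraph V) :
    set ('cV[R]_#|V| * R * R) :=
  [set t | let: (f, l, mu) := t in
     [/\ (distmx R G - l%:M) *m f = (mu / 2) *: ones R #|V|,
         dotv (ones R #|V|) f = 0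
       & dotv f f = 1]].

Definition stationary_lambda (R : realType) (V : finType) (G : sgraph V) :
    set R :=
  [set l | exists f mu, stationary G (f, l, mu)].

(* proj_mx and eigenspace act on row vectors, hence the transposition; the row
   space of kermx U^T is the orthogonal complement of that of U. *)
Definition eigenproj (R : realType) n (A : 'M[R]_n) (a : R) : 'M[R]_n :=
  (proj_mx (eigenspace A a) (kermx (eigenspace A a)^T))^T.

Section OmegaPsi.
Variables (R : realType) (V : finType) (H : sgraph V).

Definition proj_ones (a : R) : 'cV[R]_#|V| :=
  eigenproj (adjmx R H) a *m ones R #|V|.

Definition main_ev : set R :=
  [set a | eigenvalue (adjmx R H) a /\ proj_ones a <> 0].

Definition omega_poles : set R := [set - a - 2 | a in main_ev `\ (- 2)].

(* The value at a point of omega_poles is irrelevant. *)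
Definition omega (l : R) : R :=
  1 + dotv (proj_ones (- 2)) (proj_ones (- 2))
  + \sum_(a \in main_ev `\ (- 2))
      l / (a + 2 + l) * dotv (proj_ones a) (proj_ones a).

Definition omega_zeros : set R := [set l | ~ omega_poles l /\ omega l = 0].

Definition lambda_star : R := maximum omega_zeros.

(* The value at a point of omega_zeros is irrelevant. *)
Definition psi (l : R) : R :=
  if `[< omega_poles l >] then 0 else l / omega l.

(* Inverse of the restriction of psi to the interval (lambda_star, +oo), on
   which psi is a bijection onto R. *)
Definition psi_star_inv (y : R) : R :=
  xget 0 [set l | lambda_star < l /\ psi l = y].

End OmegaPsi.

Definition gamma3 (R : realType) (V1 V2 : finType)
    (G : sgraph V1) (H : sgraph V2) : \bar R :=
  maximum_ninfty
    (stationary_lambda (corona G H)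
     `&` [set l : R | \det (adjmx R H + 2%:M + l%:M) = 0]).

(* Main.v *)
(* QEC(G) is the largest stationary value: a maximiser f of <f, D f> on the unit
   sphere of the hyperplane <1, f> = 0 satisfies D f - l f in R 1. For f on the
   corona, with value g(x) at x and h_x on the copy of H at x, put
   s(x) = g(x) + <1, h_x>. The stationarity equations become
     (A_H + 2 + l) h_x = l g(x) 1   and   D_G s - l g constant.
   If A_H + 2 + l is invertible, the first one gives s = omega_H(l) g, and l is
   stationary for the corona iff psi_H(l) is stationary for G when
   omega_H(l) <> 0; monotonicity of psi_H beyond lambda_* then identifies the
   largest such l.

   The behaviour of psi_H comes from 1 / psi_H(l) = omega_H(l) / l, which is a
   sum of W_p / (l - p) with W_p > 0 over the poles p of omega_H and p = 0. Its
   largest zero lambda_* lies between its two largest poles, and clearing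
   denominators writes psi_H as a quotient of two polynomials. *)

Require Import Defs.
From mathcomp Require Import all_boot all_order all_algebra.
From mathcomp Require Import boolp classical_sets fsbigop reals constructive_ereal.
From mathcomp Require Import topology normedtype derive.
From mathcomp Require Import polyrcf ring lra.

Set Implicit Arguments.
Unset Strict Implicit.
Unset Printing Implicit Defensive.

Import Order.TTheory GRing.Theory Num.Theory.
Import numFieldNormedType.Exports.
Local Open Scope ring_scope.

(** * Rayleigh quotients on a subspace *)

Section Dotv.
Variables (R : realType) (n : nat).
Implicit Types u v w : 'cV[R]_n.

Lemma dotvC u v : dotv u v = dotv v u.
Proof. by apply: eq_bigr => i _; rewrite mulrC. Qed.

Lemma dotvDr u v w : dotv u (v + w) = dotv u v + dotv u w.
Proof. by rewrite /dotv -big_split; apply: eq_bigr => i _; rewrite mxE mulrDr. Qed.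

Lemma dotvZr a u v : dotv u (a *: v) = a * dotv u v.
Proof. by rewrite /dotv mulr_sumr; apply: eq_bigr => i _; rewrite mxE mulrCA. Qed.

Lemma dotvDl u v w : dotv (u + v) w = dotv u w + dotv v w.
Proof. by rewrite dotvC dotvDr !(dotvC w). Qed.

Lemma dotvZl a u v : dotv (a *: u) v = a * dotv u v.
Proof. by rewrite dotvC dotvZr dotvC. Qed.

Lemma dotv0 u : dotv u 0 = 0.
Proof. by rewrite -(scale0r 0) dotvZr mul0r. Qed.

Lemma dotvBr u v w : dotv u (v - w) = dotv u v - dotv u w.
Proof. by rewrite dotvDr -scaleN1r dotvZr mulN1r. Qed.

Lemma dotv_sumr (I : Type) (r : seq I) (F : I -> 'cV[R]_n) u :
  dotv u (\sum_(i <- r) F i) = \sum_(i <- r) dotv u (F i).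
Proof.
by elim: r => [|i r IH]; rewrite ?big_nil ?dotv0// !big_cons dotvDr IH.
Qed.

Lemma dotv_mx u v : dotv u v = (u^T *m v) 0 0.
Proof. by rewrite mxE; apply: eq_bigr => i _; rewrite mxE. Qed.

Lemma dotvv_ge0 u : 0 <= dotv u u.
Proof. by apply: sumr_ge0 => i _; rewrite -expr2 sqr_ge0. Qed.

Lemma dotvv_eq0 u : (dotv u u == 0) = (u == 0).
Proof.
apply/eqP/eqP => [/eqP|->]; last by rewrite dotv0.
rewrite psumr_eq0 => [/allP u0|i _]; last by rewrite -expr2 sqr_ge0.
apply/matrixP => i j; rewrite !ord1 mxE; apply/eqP.
by have := u0 i (mem_index_enum i); rewrite mulf_eq0 orbb.
Qed.

Lemma dotv_unit u : u != 0 ->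
  dotv ((Num.sqrt (dotv u u))^-1 *: u) ((Num.sqrt (dotv u u))^-1 *: u) = 1.
Proof.
move=> u0; rewrite dotvZl dotvZr mulrA -invfM -expr2 sqr_sqrtr ?dotvv_ge0//.
by rewrite mulVf// dotvv_eq0.
Qed.

End Dotv.

Lemma dotv_mulmx (R : realType) m n (A : 'M[R]_(m, n)) u v :
  dotv u (A *m v) = dotv (A^T *m u) v.
Proof. by rewrite !dotv_mx trmx_mul trmxK mulmxA. Qed.

Lemma dotv_sym (R : realType) n (A : 'M[R]_n) u v :
  A^T = A -> dotv u (A *m v) = dotv v (A *m u).
Proof. by move=> As; rewrite dotv_mulmx As dotvC. Qed.

Section Rayleigh.
Variables (R : realType) (n k : nat) (B : 'M[R]_n) (W : 'M[R]_(k, n)).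
Hypothesis B_sym : B^T = B.

Lemma continuous_dotv_mulmx (C : 'M[R]_n) :
  continuous (fun v : 'rV[R]_n => dotv v^T (C *m v^T)).
Proof.
have coordc i : continuous (fun v : 'rV[R]_n => v^T i 0).
  by under eq_fun do rewrite mxE; exact: coord_continuous.
have mulc i : continuous (fun v : 'rV[R]_n => (C *m v^T) i 0).
  under eq_fun do rewrite mxE.
  apply: continuous_big; first exact: add_continuous.
  by move=> j _ y; apply: continuousM; [exact: cst_continuous|exact: coordc].
apply: continuous_big; first exact: add_continuous.
by move=> i _ x; apply: continuousM; [exact: coordc|exact: mulc].
Qed.

(** The unit sphere of the kernel of [W] is compact, and nonempty because [u] can be normalised, so
    a continuous quadratic form attains its maximum on it. Row vectors appear only to match
    [EVT_max_rV]. *)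
Lemma rayleigh_max (u : 'cV[R]_n) : W *m u = 0 -> u != 0 ->
  exists v, [/\ W *m v = 0, dotv v v = 1 &
    forall w, W *m w = 0 -> dotv w w = 1 -> dotv w (B *m w) <= dotv v (B *m v)].
Proof.
move=> Wu u0.
pose A := [set v : 'rV[R]_n | W *m v^T = 0 /\ dotv v^T v^T = 1]%classic.
have cN : continuous (fun v : 'rV[R]_n => dotv v^T v^T).
  by have := @continuous_dotv_mulmx 1%:M; under eq_fun do rewrite mul1mx.
have Acpt : compact A.
  apply: bounded_closed_compact.
    exists 1; split => // x x1 v [_ v1] /=.
    rewrite [leLHS]/Num.norm /= mx_normrE; apply/bigmax_leP; split => [|[i j] _] /=.
      exact: le_trans (ltW x1).
    apply: le_trans (ltW x1); rewrite -(@expr_le1 _ 2)// real_normK ?num_real//.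
    rewrite -v1 /dotv (bigD1 j)//= !mxE (ord1 i) -expr2 lerDl.
    by apply: sumr_ge0 => l _; rewrite -expr2 sqr_ge0.
  (* The matrix condition [W v = 0] becomes one real equation, [|W v|^2 = 0], so that closedness
     follows from continuity of quadratic forms. *)
  have -> : A = ((fun v : 'rV[R]_n => dotv v^T ((W^T *m W) *m v^T)) @^-1` [set x | x = 0]
     `&` (fun v : 'rV[R]_n => dotv v^T v^T) @^-1` [set x | x = 1])%classic.
    apply/seteqP; split => v /= [v0 v1]; split => //.
      by rewrite -mulmxA v0 mulmx0 dotv0.
    apply/eqP; rewrite -dotvv_eq0; apply/eqP.
    by rewrite -[RHS]v0 -mulmxA [RHS]dotv_mulmx trmxK.
  apply: closedI; apply: (@preimage_closed _ _ _ [set x | x = _]%classic).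
  - by move=> v _; exact: continuous_dotv_mulmx.
  - exact: closed_eq.
  - by move=> v _; exact: cN.
  - exact: closed_eq.
have A0 : (A !=set0)%classic.
  exists ((Num.sqrt (dotv u u))^-1 *: u)^T; split; rewrite trmxK.
    by rewrite -scalemxAr Wu scaler0.
  exact: dotv_unit.
have [|c /set_mem[c1 c2] cmax] := EVT_max_rV A0 Acpt (f := fun v => dotv v^T (B *m v^T)).
  by apply: continuous_subspaceT; exact: continuous_dotv_mulmx.
exists c^T; split => // w w0 w1.
by have := cmax w^T; rewrite trmxK; apply; apply/mem_set; rewrite /A/= trmxK.
Qed.

(** First-order condition at a maximiser: by homogeneity the bound extends to the whole kernel of
    [W], and testing it on [v + t u] gives [2 t X <= t^2 C] for every [t], which forces [X = 0]. *)
Lemma rayleigh_stationary (v : 'cV[R]_n) :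
  W *m v = 0 -> dotv v v = 1 ->
  (forall w, W *m w = 0 -> dotv w w = 1 -> dotv w (B *m w) <= dotv v (B *m v)) ->
  forall u, W *m u = 0 -> dotv u (B *m v - dotv v (B *m v) *: v) = 0.
Proof.
move=> Wv v1 vmax u Wu; set l := dotv v (B *m v).
have homog w : W *m w = 0 -> dotv w (B *m w) <= l * dotv w w.
  move=> Ww; have [->|w0] := eqVneq w 0; first by rewrite mulmx0 !dotv0 mulr0.
  have ww_gt0 : 0 < dotv w w by rewrite lt_def dotvv_eq0 w0 dotvv_ge0.
  have := vmax _ _ (dotv_unit w0); rewrite -!scalemxAr Ww scaler0 => /(_ erefl).
  rewrite dotvZl dotvZr mulrA -invfM -expr2 sqr_sqrtr ?dotvv_ge0//.
  by rewrite mulrC ler_pdivrMr.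
set X := dotv _ _; pose C := l * dotv u u - dotv u (B *m u).
have XE : X = dotv u (B *m v) - l * dotv u v by rewrite /X dotvBr dotvZr.
have quad t : 2 * t * X <= t ^+ 2 * C.
  have := homog (v + t *: u); rewrite !mulmxDr -!scalemxAr Wv Wu scaler0 addr0.
  move=> /(_ erefl); rewrite !(dotvDl, dotvDr, dotvZl, dotvZr) (dotv_sym v u)//.
  by rewrite v1 (dotvC v u) -/l XE /C; lra.
have C0 : 0 <= C by rewrite /C subr_ge0 homog.
(* The optimal [t] would be [X / C], but [C] may vanish; with [C + 1] the inequality becomes
   [X^2 (C + 2) <= 0]. *)
have := quad (X / (C + 1)) => H.
have C1 : C + 1 != 0 by rewrite gt_eqF// ltr_wpDl.
have : 2 * X ^+ 2 * (C + 1) <= X ^+ 2 * C.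
  have := ler_wpM2r (sqr_ge0 (C + 1)) H.
  by congr (_ <= _); field.
have := sqr_ge0 X => X2 H2.
apply/eqP; rewrite -sqrf_eq0 eq_le X2 andbT; nra.
Qed.

End Rayleigh.

(** * Spectral decomposition of a real symmetric matrix *)

Section SpectralDecomposition.
Variables (R : realType) (n : nat) (A : 'M[R]_n).
Hypothesis A_sym : A^T = A.

(** Symmetry identifies left and right eigenvectors; this links the row-space [eigenspace] with
    column vectors. *)
Lemma eigenspace_tr (u : 'cV[R]_n) a :
  (u^T <= eigenspace A a)%MS = (A *m u == a *: u).
Proof.
apply/eigenspaceP/eqP => [|Au].
  by move/(congr1 trmx); rewrite trmx_mul trmxK A_sym linearZ /= trmxK.
by rewrite -[A in LHS]A_sym -trmx_mul Au linearZ.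
Qed.

Lemma eigenspace_ortho a b (u : 'cV[R]_n) :
  A *m u = b *: u -> b != a -> eigenspace A a *m u = 0.
Proof.
move=> Au ba; have := congr1 (mulmx (eigenspace A a)) Au.
rewrite mulmxA (eigenspaceP (submx_refl _)) -scalemxAr -scalemxAl => /eqP.
by rewrite eq_sym -subr_eq0 -scalerBl scaler_eq0 subr_eq0 (negPf ba) => /eqP.
Qed.

Definition eigenvals : seq R := rootsR (char_poly A).

Lemma mem_eigenvals a : (a \in eigenvals) = eigenvalue A a.
Proof.
rewrite -roots_on_rootsR ?monic_neq0 ?char_poly_monic//.
by rewrite in_itv /= eigenvalue_root_char.
Qed.

Lemma uniq_eigenvals : uniq eigenvals.
Proof. exact: uniq_roots. Qed.

(* The orthogonal complement of the sum of all eigenspaces is A-invariant, so if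
   it were nonzero a Rayleigh maximiser in it would be an eigenvector. *)
Lemma sum_eigenspaces_full :
  row_full (\sum_(i < size eigenvals) eigenspace A eigenvals`_i)%MS.
Proof.
set U := (\sum_(i < _) _)%MS.
have UA : (U *m A <= U)%MS.
  rewrite sumsmxMr; apply/sumsmx_subP => i _.
  apply: submx_trans (sumsmx_sup i _ (submx_refl _)) => //.
  by rewrite (eigenspaceP (submx_refl _)) scalemx_sub.
case/submxP: UA => X UA.
rewrite -cokermx_eq0; apply/negPn/negP => /eqP coker.
(* A nonzero column of the cokernel is a nonzero vector orthogonal to all eigenspaces. *)
have [j cj] : exists j, col j (cokermx U) != 0.
  apply: contrapT => no; apply: coker; apply/matrixP => i j.
  have [c0|c0] := eqVneq (col j (cokermx U)) 0; last by case: no; exists j.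
  by move/colP: c0 => /(_ i); rewrite !mxE.
have Uc : U *m col j (cokermx U) = 0 by rewrite colE mulmxA mulmx_coker mul0mx.
have [v [Uv v1 vmax]] := rayleigh_max A Uc cj.
have stat := rayleigh_stationary A_sym Uv v1 vmax.
set l := dotv v (A *m v) in stat.
have Av : A *m v = l *: v.
  apply/eqP; rewrite -subr_eq0 -dotvv_eq0; apply/eqP; apply: stat.
  (* By invariance [A v - l v] is itself orthogonal to [U], so stationarity can be tested against it
     and gives that its norm is 0. *)
  by rewrite mulmxBr mulmxA UA -mulmxA Uv mulmx0 -scalemxAr Uv scaler0 subr0.
have vE : (v^T <= eigenspace A l)%MS by rewrite eigenspace_tr Av.
have lev : l \in eigenvals.
  rewrite mem_eigenvals; apply/eigenvalueP; exists v^T; first exact/eigenspaceP.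
  by rewrite trmx_eq0 -dotvv_eq0 v1 oner_eq0.
have vU : (v^T <= U)%MS.
  apply: submx_trans vE _.
  have il : (index l eigenvals < size eigenvals)%N by rewrite index_mem.
  by apply: (sumsmx_sup (Ordinal il)) => //=; rewrite nth_index.
case/submxP: vU => Y vU.
by move: v1; rewrite dotv_mx vU -mulmxA Uv mulmx0 mxE => /eqP; rewrite eq_sym oner_eq0.
Qed.

(** A vector of the intersection is orthogonal to itself. This is the side condition under which
    [proj_mx] in [eigenproj] is a genuine projection. *)
Lemma eigenspace_cap_ortho a :
  (eigenspace A a :&: kermx (eigenspace A a)^T = 0)%MS.
Proof.
apply/eqP; rewrite -submx0; apply/rV_subP => w.
rewrite sub_capmx => /andP[/submxP[X wX] /sub_kermxP wk].
rewrite submx0 -trmx_eq0 -dotvv_eq0 dotv_mx trmxK.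
by rewrite {1}wX -mulmxA -[X in _ *m X]trmxK trmx_mul trmxK wk trmx0 mulmx0 mxE.
Qed.

Lemma eigenproj_eigen a (u : 'cV[R]_n) :
  A *m (eigenproj A a *m u) = a *: (eigenproj A a *m u).
Proof.
apply/eqP; rewrite -eigenspace_tr /eigenproj trmx_mul trmxK.
by rewrite proj_mx_sub.
Qed.

Lemma eigenproj_id a (u : 'cV[R]_n) : A *m u = a *: u -> eigenproj A a *m u = u.
Proof.
move=> Au; apply: trmx_inj; rewrite /eigenproj trmx_mul trmxK.
by rewrite proj_mx_id ?eigenspace_cap_ortho// eigenspace_tr Au.
Qed.

Lemma eigenproj_0 a b (u : 'cV[R]_n) :
  A *m u = b *: u -> b != a -> eigenproj A a *m u = 0.
Proof.
move=> Au ba; apply: trmx_inj; rewrite /eigenproj trmx_mul trmxK trmx0.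
rewrite proj_mx_0 ?eigenspace_cap_ortho//.
by apply/sub_kermxP; rewrite -trmx_mul (eigenspace_ortho Au ba) trmx0.
Qed.

Lemma eigenproj_out a (u : 'cV[R]_n) :
  ~~ eigenvalue A a -> eigenproj A a *m u = 0.
Proof.
move=> /negP nev; apply/eqP/negPn/negP => p0; apply: nev.
apply/eigenvalueP; exists (eigenproj A a *m u)^T; last by rewrite trmx_eq0.
by apply/eigenspaceP; rewrite eigenspace_tr eigenproj_eigen.
Qed.

(** Since the eigenspaces span, [u] is some sum of eigenvectors [F a]; applying [eigenproj A a]
    keeps [F a] and kills the others. *)
Lemma eigenproj_sum (u : 'cV[R]_n) :
  u = \sum_(a <- eigenvals) eigenproj A a *m u.
Proof.
have : (u^T <= \sum_(i < size eigenvals) eigenspace A eigenvals`_i)%MS.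
  by rewrite submx_full// sum_eigenspaces_full.
case/sub_sumsmxP => X uX.
pose F a := (\sum_(i < size eigenvals | eigenvals`_i == a)
  X i *m eigenspace A eigenvals`_i)^T.
have FA a : A *m F a = a *: F a.
  apply/eqP; rewrite -eigenspace_tr trmxK.
  by apply: summx_sub => i /eqP ->; rewrite submxMl.
have uF : u = \sum_(a <- eigenvals) F a.
  apply: trmx_inj; rewrite uX linear_sum /= (big_nth 0) big_mkord.
  apply: eq_bigr => i _; rewrite trmxK (big_pred1 i)// => j.
  by rewrite nth_uniq ?uniq_eigenvals.
rewrite [LHS]uF; apply: eq_big_seq => a aev.
rewrite uF mulmx_sumr (bigD1_seq a) ?uniq_eigenvals//= eigenproj_id//.
by rewrite big1 ?addr0// => b ba; rewrite (eigenproj_0 (FA b)).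
Qed.

(** In the spectral decomposition of [u], components for eigenvalues other than [a] are orthogonal
    to the [a]-component. *)
Lemma eigenproj_dot a (u : 'cV[R]_n) :
  dotv u (eigenproj A a *m u) = dotv (eigenproj A a *m u) (eigenproj A a *m u).
Proof.
have [aev|/eigenproj_out ->] := boolP (eigenvalue A a); last by rewrite !dotv0.
rewrite dotvC {2}(eigenproj_sum u) dotv_sumr.
rewrite (bigD1_seq a) ?mem_eigenvals ?uniq_eigenvals//= big1 ?addr0// => b ba.
move: (eigenproj A a *m u) (eigenproj A b *m u) (eigenproj_eigen a u)
  (eigenproj_eigen b u) => v w Av Aw.
have /eqP := dotv_sym v w A_sym.
rewrite Av Aw !dotvZr (dotvC w) -subr_eq0 -mulrBl mulf_eq0 subr_eq0 (negPf ba).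
by move=> /eqP.
Qed.

End SpectralDecomposition.

(** * Sums of simple poles with positive residues *)

Section PoleSum.
Variables (R : realType) (W : R -> R).
Implicit Types (S : seq R) (l : R).

Definition pole_sum S l : R := \sum_(p <- S) W p / (l - p).

Definition pole_den S : {poly R} := \prod_(p <- S) ('X - p%:P).

(** The numerator of [pole_sum] over the denominator [pole_den]. With polynomials the intermediate
    value theorem applies across the poles, where [pole_den / pole_num] extends the reciprocal of
    [pole_sum] by 0. *)
Definition pole_num S : {poly R} :=
  \sum_(p <- S) W p *: \prod_(q <- S | q != p) ('X - q%:P).

Lemma pole_denE S l : (pole_den S).[l] = \prod_(p <- S) (l - p).
Proof. by rewrite horner_prod; apply: eq_bigr => p _; rewrite hornerXsubC. Qed.

Lemma pole_numE S l :
  (pole_num S).[l] = \sum_(p <- S) W p * \prod_(q <- S | q != p) (l - q).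
Proof.
rewrite horner_sum; apply: eq_bigr => p _; rewrite hornerZ horner_prod.
by congr (_ * _); apply: eq_bigr => q _; rewrite hornerXsubC.
Qed.

Lemma pole_den_neq0 S l : l \notin S -> (pole_den S).[l] != 0.
Proof.
move=> lS; rewrite pole_denE prodf_seq_neq0; apply/allP => p pS /=.
by rewrite subr_eq0; apply: contraNneq lS => ->.
Qed.

Lemma pole_den_eq0 S l : l \in S -> (pole_den S).[l] = 0.
Proof. by move=> lS; rewrite pole_denE (big_rem l)//= subrr mul0r. Qed.

Lemma pole_num_sum S l : uniq S -> l \notin S ->
  (pole_num S).[l] = (pole_den S).[l] * pole_sum S l.
Proof.
move=> Su lS; rewrite pole_numE pole_denE mulr_sumr; apply: eq_big_seq => p pS.
rewrite [in RHS](bigD1_seq p)//=.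
have lp : l - p != 0 by rewrite subr_eq0; apply: contraNneq lS => ->.
by field.
Qed.

Lemma pole_num_pole S l : uniq S -> l \in S ->
  (pole_num S).[l] = W l * \prod_(q <- S | q != l) (l - q).
Proof.
move=> Su lS; rewrite pole_numE (bigD1_seq l)//= [X in _ + X]big1 ?addr0// => p pl.
by rewrite -big_filter (big_rem l) ?mem_filter 1?eq_sym ?pl//= subrr mul0r mulr0.
Qed.

(** * Signs and monotonicity above the second largest pole *)

Variables (P1 P2 : R) (S : seq R).
Let SS := [:: P1, P2 & S].
Hypothesis P21 : P2 < P1.
Hypothesis S_lt : {in S, forall p, p < P2}.
Hypothesis S_uniq : uniq S.
Hypothesis W_gt0 : {in SS, forall p, 0 < W p}.

Let SS_uniq : uniq SS.
Proof.
rewrite /= S_uniq andbT inE negb_or gt_eqF//=; apply/andP; split.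
  by apply/negP => /S_lt /lt_trans/(_ P21); rewrite ltxx.
by apply/negP => /S_lt; rewrite ltxx.
Qed.

Let lt_S l p : P2 < l -> p \in P2 :: S -> p < l.
Proof.
by move=> ?; rewrite inE => /predU1P[->//|/S_lt]; move/lt_trans; apply.
Qed.

Let out_SS l : P2 < l -> l != P1 -> l \notin SS.
Proof.
move=> P2l lP1; rewrite inE (negPf lP1) /=; apply/negP => /(lt_S P2l).
by rewrite ltxx.
Qed.

(** Each term decreases on an interval that avoids its pole: the product hypothesis puts [a] and [b]
    on the same side of [P1], and both exceed all other poles. *)
Lemma pole_sum_decr a b : P2 < a -> a < b -> 0 < (a - P1) * (b - P1) ->
  pole_sum SS b < pole_sum SS a.
Proof.
move=> P2a ab ab1.
have step p : 0 < W p -> 0 < (a - p) * (b - p) -> W p / (b - p) < W p / (a - p).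
  move=> Wp abp; rewrite ltr_pM2l// -subr_gt0.
  have : (a - p) * (b - p) != 0 by rewrite gt_eqF.
  rewrite mulf_eq0 negb_or => /andP[ap bp].
  have -> : (a - p)^-1 - (b - p)^-1 = (b - a) / ((a - p) * (b - p)) by field; lra.
  by rewrite divr_gt0// subr_gt0.
rewrite /pole_sum !(big_cons _ _ P1); apply: ltr_leD.
  by apply: step => //; rewrite W_gt0// mem_head.
rewrite big_seq [leRHS]big_seq; apply: ler_sum => p pS.
apply: ltW; apply: step; first by rewrite W_gt0// inE pS orbT.
by rewrite mulr_gt0// subr_gt0 lt_S// (lt_trans P2a).
Qed.

Lemma pole_sum_gt0 l : P1 < l -> 0 < pole_sum SS l.
Proof.
move=> P1l; have P2l := lt_trans P21 P1l.
rewrite /pole_sum big_cons ltr_pwDl//.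
  by rewrite divr_gt0 ?subr_gt0// W_gt0// mem_head.
rewrite big_seq sumr_ge0// => p pS.
by rewrite divr_ge0 ?subr_ge0 ?(ltW (lt_S P2l pS))// ltW// W_gt0// inE pS orbT.
Qed.

Let prod_gt0 l : P2 < l -> 0 < \prod_(p <- P2 :: S) (l - p).
Proof.
by move=> P2l; rewrite big_seq prodr_gt0// => p /(lt_S P2l); rewrite subr_gt0.
Qed.

Lemma pole_den_sign l : P2 < l ->
  ((0 < (pole_den SS).[l]) = (P1 < l)) * (((pole_den SS).[l] < 0) = (l < P1)).
Proof.
move=> P2l; rewrite pole_denE big_cons; have := prod_gt0 P2l => pos.
by rewrite pmulr_lgt0// pmulr_llt0// subr_gt0 subr_lt0.
Qed.

Lemma pole_num_last : 0 < (pole_num SS).[P1].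
Proof.
rewrite pole_num_pole ?mem_head// mulr_gt0 ?W_gt0 ?mem_head//.
rewrite big_cons eqxx /= big_seq_cond prodr_gt0// => p /andP[pS _].
by rewrite subr_gt0 lt_S.
Qed.

(** At a pole only its own summand survives; here [P2 - P1] is the one negative factor. *)
Lemma pole_num_prev : (pole_num SS).[P2] < 0.
Proof.
have P2S : P2 \in SS by rewrite !inE eqxx orbT.
rewrite pole_num_pole// pmulr_rlt0 ?W_gt0//.
rewrite big_cons gt_eqF//= big_cons eqxx /= pmulr_llt0 ?subr_lt0//.
by rewrite big_seq_cond prodr_gt0// => p /andP[pS _]; rewrite subr_gt0 S_lt.
Qed.

(** The numerator changes sign between [P2] and [P1]. From its root [r] up to [P1] the sum decreases
    from 0 and the denominator is negative; beyond [P1] both are positive. *)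
Lemma pole_num_top_root : exists r,
  [/\ P2 < r, r < P1, (pole_num SS).[r] = 0 & forall l, r < l -> 0 < (pole_num SS).[l]].
Proof.
have [|r /andP[r2 r1] /rootP r0] := poly_ivt (p := pole_num SS) (ltW P21).
  by rewrite !ltW ?pole_num_last ?pole_num_prev.
have {}r1 : r < P1.
  by rewrite lt_neqAle r1 andbT; apply: contra_eq_neq r0 => ->; rewrite gt_eqF ?pole_num_last.
have {}r2 : P2 < r.
  by rewrite lt_neqAle r2 andbT; apply: contra_eq_neq r0 => <-; rewrite lt_eqF ?pole_num_prev.
exists r; split => // l rl.
have P2l := lt_trans r2 rl.
have rsum : pole_sum SS r = 0.
  have rS : r \notin SS by rewrite out_SS ?lt_eqF.
  move/eqP: r0; rewrite pole_num_sum// mulf_eq0.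
  by rewrite lt_eqF ?(pole_den_sign r2)//= => /eqP.
have [lP|Pl|->] := ltgtP l P1; last exact: pole_num_last.
  rewrite pole_num_sum ?out_SS ?lt_eqF// nmulr_rgt0 ?pole_den_sign//.
  by rewrite -rsum pole_sum_decr// nmulr_rgt0 subr_lt0.
by rewrite pole_num_sum ?out_SS ?gt_eqF// mulr_gt0 ?pole_den_sign ?pole_sum_gt0.
Qed.

Section AboveTopRoot.
Variable r : R.
Hypothesis r_gt : P2 < r.
Hypothesis r_lt : r < P1.
Hypothesis r_root : (pole_num SS).[r] = 0.
Hypothesis num_gt0 : forall l, r < l -> 0 < (pole_num SS).[l].

Lemma pole_ratio_surj y : exists2 l, r < l &
  (pole_den SS).[l] = y * (pole_num SS).[l].
Proof.
pose c := \sum_(p <- SS) W p.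
have c_gt0 : 0 < c.
  rewrite /c big_cons ltr_pwDl ?W_gt0 ?mem_head// big_seq sumr_ge0// => p pS.
  by rewrite ltW// W_gt0// inE pS orbT.
(* Chosen so that [c / (b - P1) = 1 / (|y| + 1)]. This bounds [pole_sum SS b], making
   [pole_den - y pole_num] nonnegative at [b], whereas at [r] it is negative. *)
pose b := P1 + (`|y| + 1) * c.
have d_gt0 : 0 < (`|y| + 1) * c by rewrite mulr_gt0// ltr_wpDl.
have P1b : P1 < b by rewrite ltrDl.
have P2b := lt_trans P21 P1b.
have rb := lt_trans r_lt P1b.
have sum_b : y * pole_sum SS b <= 1.
  have sum_le : pole_sum SS b <= c / (b - P1).
    rewrite /pole_sum /c mulr_suml !big_seq; apply: ler_sum => p pS.
    have pP1 : p <= P1.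
      by move: pS; rewrite inE => /predU1P[->//|/(lt_S P21)/ltW].
    apply: ler_wpM2l; first by rewrite ltW ?W_gt0.
    by rewrite lef_pV2 ?posrE ?subr_gt0 ?lerB// (le_lt_trans pP1).
  have -> : 1 = (`|y| + 1) * (c / (b - P1)).
    by rewrite /b addrAC subrr add0r mulrA divff// gt_eqF.
  apply: le_trans (ler_wpM2r (ltW (pole_sum_gt0 P1b)) (ler_norm y)) _.
  apply: ler_pM => //; first exact/ltW/pole_sum_gt0.
  by rewrite lerDl.
have [|l /andP[rl lb] /rootP] :=
    poly_ivt (p := pole_den SS - y *: pole_num SS) (ltW rb).
  rewrite !hornerE r_root mulr0 subr0 ltW ?pole_den_sign//=.
  rewrite pole_num_sum ?out_SS ?gt_eqF// mulrCA -[X in X - _]mulr1 -mulrBr.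
  by rewrite mulr_ge0 ?subr_ge0// ltW// pole_den_sign.
rewrite !hornerE => /eqP; rewrite subr_eq0 => /eqP le; exists l => //.
rewrite lt_neqAle rl andbT; apply/eqP => rle.
have := pole_den_sign r_gt; rewrite rle le -rle r_root mulr0 ltxx => -[_].
by rewrite r_lt.
Qed.

(** Away from [P1] the ratio is the reciprocal of [pole_sum], which decreases with constant sign on
    each side of [P1]. The ratio is negative before [P1], 0 at [P1] and positive after it. *)
Lemma pole_ratio_incr a b : r < a -> a < b ->
  (pole_den SS).[a] / (pole_num SS).[a] < (pole_den SS).[b] / (pole_num SS).[b].
Proof.
move=> ra ab; have rb := lt_trans ra ab.
have P2a := lt_trans r_gt ra; have P2b := lt_trans r_gt rb.
have [Na Nb] := (num_gt0 ra, num_gt0 rb).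
have inv l : P2 < l -> l != P1 ->
    (pole_den SS).[l] / (pole_num SS).[l] = (pole_sum SS l)^-1.
  move=> P2l lP1; rewrite pole_num_sum ?out_SS// invfM mulrA divff ?mul1r//.
  exact/pole_den_neq0/out_SS.
have [aP|Pa] := ltP a P1; last first.
  have Pb := le_lt_trans Pa ab.
  have [<-|Pa'] := eqVneq P1 a.
    by rewrite pole_den_eq0 ?mem_head// mul0r divr_gt0 ?pole_den_sign.
  have {}Pa : P1 < a by rewrite lt_neqAle Pa'.
  rewrite !inv ?gt_eqF// ltf_pV2 ?posrE ?pole_sum_gt0// pole_sum_decr//.
  by rewrite mulr_gt0 ?subr_gt0.
have [bP|Pb] := ltP b P1; last first.
  apply: (@lt_le_trans _ _ 0); first by rewrite pmulr_llt0 ?invr_gt0 ?pole_den_sign.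
  rewrite divr_ge0 ?(ltW Nb)// leNgt pole_den_sign//.
  by rewrite -leNgt.
rewrite !inv ?lt_eqF// ltf_nV2 ?negrE.
- by rewrite pole_sum_decr// nmulr_rgt0 subr_lt0.
- move: Na; rewrite pole_num_sum ?out_SS ?lt_eqF// nmulr_rgt0//.
  by rewrite pole_den_sign.
- move: Nb; rewrite pole_num_sum ?out_SS ?lt_eqF// nmulr_rgt0//.
  by rewrite pole_den_sign.
Qed.

End AboveTopRoot.

End PoleSum.

(** * Distances in a corona *)

Section Distance.
Variables (V : finType) (G : sgraph V).
Local Open Scope nat_scope.

Lemma dist_le x p : path G x p -> dist G x (last x p) <= size p.
Proof.
move=> Gp; rewrite leqNgt; apply/negP => lt_p.
(* [find] never exceeds [#|V|], so [size p] falls inside the range searched by [dist]. *)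
have p_lt : size p < #|V|.
  by apply: leq_trans lt_p _; rewrite -[leqRHS](size_iota 0) find_size.
have /negbT/negP := before_find 0 lt_p; rewrite nth_iota// add0n /=; apply.
by apply/existsP; exists (in_tuple p); rewrite Gp eqxx.
Qed.

(** Removing repeated vertices from a connecting walk makes it shorter than [#|V|], so the search in
    [dist] succeeds. *)
Lemma dist_walk x y : connect G x y ->
  exists p, [/\ path G x p, last x p = y & size p = dist G x y].
Proof.
move=> /connectP[p Gp ->{y}]; case/shortenP: Gp => p' Gp' p'_uniq _.
have p'_lt : size p' < #|V| by rewrite -[_.+1]/(size (x :: p')) -(card_uniqP p'_uniq) max_card.
have : has (fun k => [exists q : k.-tuple V, path G x q && (last x q == last x p')])
    (iota 0 #|V|).
  apply/hasP; exists (size p'); first by rewrite mem_iota.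
  by apply/existsP; exists (in_tuple p'); rewrite Gp' eqxx.
move=> hasd; have := nth_find 0 hasd; move: hasd; rewrite has_find size_iota => d_lt.
rewrite nth_iota// add0n /= => /existsP[q /andP[Gq /eqP qp']].
by exists q; rewrite size_tuple.
Qed.

Lemma distxx x : dist G x x = 0.
Proof. by apply/eqP; rewrite -leqn0 (@dist_le x [::]). Qed.

Lemma dist_sym x y : dist G x y = dist G y x.
Proof.
have Gsym : (fun u => G^~ u) =2 G by move=> u v; exact: edge_sym.
have rev_walk u v p : path G u p -> last u p = v ->
    exists q, [/\ path G v q, last v q = u & size q = size p].
  move=> Gp <-; exists (rev (belast u p)).
  rewrite size_rev size_belast rev_path (eq_path Gsym).
  by split => //; case: p Gp => //= w p _; rewrite rev_cons last_rcons.
rewrite /dist; apply: eq_find => k.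
by apply/existsP/existsP => -[p /andP[Gp /eqP pl]];
  have [q [Gq ql qs]] := rev_walk _ _ _ Gp pl; rewrite size_tuple in qs;
  exists (tcast qs (in_tuple q)); rewrite val_tcast /= Gq ql eqxx.
Qed.

(* Any function that vanishes at [x] and grows by at most one along edges is a
   lower bound for the length of walks from [x]. *)
Lemma lipschitz_walk (d : V -> nat) x p :
  (forall u v, G u v -> d v <= (d u).+1) -> path G x p ->
  d (last x p) <= d x + size p.
Proof.
move=> lip; elim: p x => [|y p IH] x /=; first by rewrite addn0.
move=> /andP[/lip dy /IH le]; apply: leq_trans le _.
by rewrite addnS -addSn leq_add2r.
Qed.

Lemma dist_edge : graph_connected G -> forall x u v,
  G u v -> dist G x v <= (dist G x u).+1.
Proof.
move=> Gc x u v; have [p [Gp <- <-]] := dist_walk (Gc x u) => Guv.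
have := @dist_le x (rcons p v); rewrite last_rcons size_rcons; apply.
by rewrite rcons_path Gp.
Qed.
End Distance.

Section CoronaDistance.
Variables (V1 V2 : finType) (G : sgraph V1) (H : sgraph V2).
Hypothesis G_connected : graph_connected G.
Local Open Scope nat_scope.

(** Distinct vertices of one copy are at distance 1 or 2, since they share the neighbour [inl x];
    this is [(~~ H a b).+1]. *)
Definition corona_dist (u v : V1 + V1 * V2) : nat :=
  match u, v with
  | inl x, inl y => dist G x y
  | inl x, inr (y, _) => (dist G x y).+1
  | inr (x, _), inl y => (dist G x y).+1
  | inr (x, a), inr (y, b) =>
      if x == y then (if a == b then 0 else (~~ H a b).+1) else (dist G x y).+2
  end.

Lemma corona_dist_lip u v w :
  corona G H v w -> corona_dist u w <= (corona_dist u v).+1.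
Proof.
case: u v w => [x|[x a]] [y|[y b]] [z|[z c]] //=.
- exact: dist_edge.
- by move=> /eqP ->.
- by move=> /eqP ->; exact: leqW.
- by case/andP => /eqP ->.
- exact: dist_edge.
- move=> /eqP ->; case: eqP => // ->; rewrite distxx.
  by case: eqP => //; case: (H a c).
- move=> /eqP ->; case: eqP => [->|_]; last by rewrite 2?leqW.
  by rewrite distxx.
- case/andP => /eqP -> bc; case: eqP => // _.
  have [->|_] := eqVneq a b; first by rewrite bc; case: ifP.
  by case: (a == c) => //; case: (H a c) => //; case: (H a b).
Qed.

Lemma corona_walk u v :
  exists p, [/\ path (corona G H) u p, last u p = v & size p = corona_dist u v].
Proof.
have lift x y : exists p, [/\ path (corona G H) (inl x) p, last (inl x) p = inl y
    & size p = dist G x y].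
  have [p [Gp <- <-]] := dist_walk (G_connected x y).
  exists (map inl p); rewrite size_map last_map; split=> //.
  by rewrite (homo_path _ Gp).
case: u v => [x|[x a]] [y|[y b]] /=; first exact: lift.
- have [p [Hp pl ps]] := lift x y; exists (rcons p (inr (y, b))).
  by rewrite rcons_path last_rcons size_rcons Hp pl ps /= eqxx.
- have [p [Hp pl ps]] := lift x y; exists (inl x :: p).
  by rewrite /= eqxx Hp pl ps.
- have [<-|xy] := eqVneq x y.
    have [<-|ab] := eqVneq a b; first by exists [::].
    have [Hab|Hab] := boolP (H a b).
      by exists [:: inr (x, b)]; rewrite /= Hab eqxx.
    by exists [:: inl x; inr (x, b)]; rewrite /= eqxx.
  have [p [Hp pl ps]] := lift x y; exists (inl x :: rcons p (inr (y, b))).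
  by rewrite /= rcons_path last_rcons size_rcons eqxx Hp pl ps /= eqxx.
Qed.

(** An explicit walk gives the upper bound; the Lipschitz property along edges bounds every walk
    from below. *)
Lemma dist_corona u v : dist (corona G H) u v = corona_dist u v.
Proof.
have [p [Hp <- ps]] := corona_walk u v.
apply/eqP; rewrite eqn_leq -{1}ps dist_le//=.
have : connect (corona G H) u (last u p) by apply/connectP; exists p.
case/dist_walk => q [Hq <- <-].
have := lipschitz_walk (@corona_dist_lip u) Hq.
suff -> : forall w, corona_dist w w = 0 by [].
by case=> [x|[x a]] /=; rewrite ?distxx ?eqxx.
Qed.

End CoronaDistance.

(** * Stationary values *)

Section Stationary.
Variables (R : realType) (V : finType) (G : sgraph V).

Lemma distmx_sym : (distmx R G)^T = distmx R G.
Proof. by apply/matrixP => i j; rewrite !mxE dist_sym. Qed.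

Lemma orth_onesE n (u : 'cV[R]_n) :
  (ones R n)^T *m u = 0 <-> dotv (ones R n) u = 0.
Proof.
rewrite dotv_mx; split=> [->|u0]; first by rewrite mxE.
by apply/matrixP => i j; rewrite !ord1 u0 mxE.
Qed.

Lemma exists_orth_ones n : (2 <= n)%N ->
  exists2 u : 'cV[R]_n, u != 0 & dotv (ones R n) u = 0.
Proof.
case: n => [|[|n]] // _; exists (delta_mx ord0 0 - delta_mx ord_max 0).
  apply/eqP => /matrixP/(_ ord0 0); rewrite !mxE !eqxx /= subr0.
  by move/eqP; rewrite oner_eq0.
have dot_delta i : dotv (ones R n.+2) (delta_mx i 0) = 1.
  rewrite /dotv (bigD1 i)//= !mxE !eqxx mul1r big1 ?addr0// => j ji.
  by rewrite !mxE (negPf ji) mulr0.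
by rewrite dotvBr !dot_delta subrr.
Qed.

(** The Rayleigh lemmas are used with the single row [W = 1^T]. Conversely, pairing a stationarity
    equation with [f] removes the multiple of 1 and leaves [l = <f, D f>]. *)
Lemma QEC_stationary : (2 <= #|V|)%N ->
  stationary_lambda G (QEC R G) /\
  forall l, stationary_lambda G l -> l <= QEC R G.
Proof.
move=> V2; have [u u0 u1] := exists_orth_ones V2.
move/orth_onesE in u1.
have [v [v1 vv vmax]] := rayleigh_max (distmx R G) u1 u0.
have QE : QEC R G = dotv v (distmx R G *m v).
  apply: maximumE; first by exists v => //; split => //; exact/orth_onesE.
  by move=> _ [w [w1 w0] <-]; apply: vmax => //; exact/orth_onesE.
split; last first.
  move=> l [f [mu [eqn f1 ff]]].
  have -> : l = dotv f (distmx R G *m f).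
    apply/esym/eqP; rewrite -subr_eq0 -[X in _ - X]mulr1 -ff -dotvZr -dotvBr.
    by rewrite -mul_scalar_mx -mulmxBl eqn dotvZr dotvC f1 mulr0.
  by rewrite QE; apply: vmax => //; exact/orth_onesE.
have := rayleigh_stationary distmx_sym v1 vv vmax.
rewrite -QE; set z := _ - _ => zorth.
have n0 : dotv (ones R #|V|) (ones R #|V|) != 0.
  rewrite dotvv_eq0; apply/eqP => /matrixP/(_ (Ordinal (ltnW V2)) 0).
  by rewrite !mxE => /eqP; rewrite oner_eq0.
(* [c 1] is the projection of [z] onto the constants. The remainder is orthogonal to 1, hence to [z]
   by stationarity, hence to itself. *)
pose c := dotv (ones R #|V|) z / dotv (ones R #|V|) (ones R #|V|).
have w1 : dotv (ones R #|V|) (z - c *: ones R #|V|) = 0.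
  by rewrite dotvBr dotvZr /c divfK// subrr.
exists v, (c * 2); split=> //; last exact/orth_onesE.
rewrite mulmxBl mul_scalar_mx -/z mulfK ?pnatr_eq0//.
apply/eqP; rewrite -subr_eq0 -dotvv_eq0 [X in _ == X](_ : 0 = dotv (z - c *: ones R #|V|) z).
  by rewrite dotvBr dotvZr [X in _ * X]dotvC w1 mulr0 subr0.
by rewrite zorth//; exact/orth_onesE.
Qed.

Lemma sum_enum_val (F : V -> R) :
  \sum_(i < #|V|) F (enum_val i) = \sum_x F x.
Proof. by rewrite [RHS](reindex _ (onW_bij _ (enum_val_bij V))). Qed.

(** Stationarity for functions on [V]: [mu / 2] becomes a free constant, and rescaling trades the
    unit norm for being nonzero. *)
Lemma stationary_lambdaP l : stationary_lambda G l <->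
  exists (f : V -> R) (c : R),
    [/\ forall x, \sum_y (dist G x y)%:R * f y = l * f x + c,
        \sum_x f x = 0 & exists x, f x != 0].
Proof.
split=> [[f [mu [eqn f1 ff]]]|[f [c [eqn f1 [x fx]]]]].
  exists (fun x => f (enum_rank x) 0), (mu / 2); split.
  - move=> x; rewrite -sum_enum_val; have /matrixP/(_ (enum_rank x) 0) := eqn.
    rewrite mulmxBl mul_scalar_mx !mxE mulr1 => /eqP; rewrite subr_eq addrC => /eqP <-.
    by apply: eq_bigr => i _; rewrite !mxE enum_rankK enum_valK.
  - rewrite -sum_enum_val -[RHS]f1; apply: eq_bigr => i _.
    by rewrite enum_valK mxE mul1r.
  - apply: contrapT => no; have f0 : f = 0.
      apply/matrixP => i j; rewrite !ord1 mxE -(enum_valK i).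
      by apply: contrapT => /eqP fi; apply: no; exists (enum_val i).
    by move/eqP: ff; rewrite f0 dotv0 eq_sym oner_eq0.
pose u : 'cV[R]_#|V| := \col_i f (enum_val i).
have u0 : u != 0.
  by apply: contra fx => /eqP/matrixP/(_ (enum_rank x) 0); rewrite !mxE enum_rankK => ->.
set k := (Num.sqrt (dotv u u))^-1.
exists (k *: u), (k * c * 2); split.
- rewrite -scalemxAr mulfK ?pnatr_eq0// -scalerA; congr (_ *: _).
  apply/matrixP => i j; rewrite !ord1 mulmxBl mul_scalar_mx !mxE mulr1.
  have -> : \sum_j distmx R G i j * u j 0 =
      \sum_(j < #|V|) (dist G (enum_val i) (enum_val j))%:R * f (enum_val j).
    by apply: eq_bigr => m _; rewrite !mxE.
  by rewrite (sum_enum_val (fun y => (dist G (enum_val i) y)%:R * f y)) eqn addrAC subrr add0r.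
- rewrite dotvZr [dotv _ _](_ : _ = 0) ?mulr0// -f1 -sum_enum_val.
  by apply: eq_bigr => i _; rewrite !mxE mul1r.
- exact: dotv_unit.
Qed.

End Stationary.

(** * The distance matrix of a corona acting on functions *)

Section CoronaSums.
Variables (R : realType) (V1 V2 : finType) (G : sgraph V1) (H : sgraph V2).
Hypothesis G_connected : graph_connected G.
Variable f : V1 + V1 * V2 -> R.

Let g x : R := f (inl x).
Let h x a : R := f (inr (x, a)).

Definition corona_fiber_sum x : R := g x + \sum_a h x a.

Lemma sum_corona (F : V1 + V1 * V2 -> R) :
  \sum_u F u = \sum_x F (inl x) + \sum_x \sum_a F (inr (x, a)).
Proof.
by rewrite big_sumType /=; congr (_ + _); rewrite pair_bigA; apply: eq_bigr => -[].
Qed.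

Lemma sum_corona_fiber : \sum_u f u = \sum_x corona_fiber_sum x.
Proof. by rewrite sum_corona -big_split. Qed.

Lemma corona_dist_sum_inl x :
  \sum_v (dist (corona G H) (inl x) v)%:R * f v =
  \sum_y (dist G x y)%:R * corona_fiber_sum y + \sum_y \sum_b h y b.
Proof.
rewrite sum_corona -!big_split /=; apply: eq_bigr => y _.
rewrite dist_corona//= mulrDr -addrA; congr (_ + _).
rewrite mulr_sumr -big_split /=; apply: eq_bigr => b _.
by rewrite dist_corona//= -addn1 natrD mulrDl mul1r.
Qed.

Lemma corona_dist_sum_inr x a :
  \sum_v (dist (corona G H) (inr (x, a)) v)%:R * f v =
  \sum_y (dist G x y)%:R * corona_fiber_sum y + \sum_y g y
  + 2 * (\sum_y \sum_b h y b) - (2 * h x a + \sum_b (H a b)%:R * h x b).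
Proof.
(* Two copy vertices are [d(x, y) + 2] apart, except within one copy, where the correction is the
   matrix [2 I + A_H]. *)
have inrE y b : (dist (corona G H) (inr (x, a)) (inr (y, b)))%:R =
    (dist G x y)%:R + 2 - (x == y)%:R * (2 * (a == b)%:R + (H a b)%:R) :> R.
  rewrite dist_corona//=; have [<-|xy] := eqVneq x y; last first.
    by rewrite -addn2 natrD mul0r subr0.
  rewrite distxx add0r mul1r; have [<-|ab] := eqVneq a b.
    by rewrite edge_irrefl /= mulr1 addr0 subrr.
  by rewrite mulr0 add0r; case: (H a b) => /=; lra.
have -> : 2 * h x a + \sum_b (H a b)%:R * h x b =
    \sum_y \sum_b (x == y)%:R * (2 * (a == b)%:R + (H a b)%:R) * h y b.
  rewrite [RHS](bigD1 x)//= [X in _ = _ + X]big1 ?addr0 => [|y yx]; last first.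
    by rewrite big1// => b _; rewrite eq_sym (negPf yx) !mul0r.
  rewrite eqxx; under [RHS]eq_bigr do rewrite mul1r mulrDl.
  rewrite big_split /=; congr (_ + _).
  rewrite (bigD1 a)//= eqxx mulr1 big1 ?addr0// => b ba.
  by rewrite eq_sym (negPf ba) mulr0 mul0r.
rewrite sum_corona mulr_sumr -!big_split -sumrB /=; apply: eq_bigr => y _.
rewrite dist_corona//= -addn1 natrD /corona_fiber_sum -/(g y).
have -> : \sum_b (dist (corona G H) (inr (x, a)) (inr (y, b)))%:R * f (inr (y, b)) =
    (dist G x y)%:R * (\sum_b h y b) + 2 * (\sum_b h y b) -
    \sum_b (x == y)%:R * (2 * (a == b)%:R + (H a b)%:R) * h y b.
  rewrite !mulr_sumr -big_split /= -sumrB; apply: eq_bigr => b _.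
  by rewrite inrE /h; ring.
by ring.
Qed.

End CoronaSums.

(** * The functions omega and psi *)

Section OmegaPsi.
Variables (R : realType) (V : finType) (H : sgraph V).
Hypothesis V_gt0 : (1 <= #|V|)%N.

Let A := adjmx R H.
Let P a := proj_ones H a : 'cV[R]_#|V|.
Let wt a : R := dotv (P a) (P a).
Let c := 1 + wt (- 2).

Lemma adjmx_sym : A^T = A.
Proof. by apply/matrixP => i j; rewrite !mxE edge_sym. Qed.

Definition main_evs : seq R :=
  [seq a <- eigenvals A | (P a != 0) && (a != - 2)].

Lemma main_evsE : (main_ev H `\ (- 2) = [set` main_evs])%classic.
Proof.
apply/seteqP; split => a /=; rewrite mem_filter mem_eigenvals.
  by move=> [[-> /eqP ->] /eqP ->].
by move=> /andP[/andP[/eqP ? /eqP ?] ?].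
Qed.

Lemma omegaE l : omega H l = c + \sum_(a <- main_evs) l / (a + 2 + l) * wt a.
Proof.
by rewrite /omega main_evsE -fsbig_seq ?filter_uniq ?uniq_eigenvals.
Qed.

Lemma det_eigenvalue l : \det (A + 2%:M + l%:M) = 0 <-> eigenvalue A (- 2 - l).
Proof.
have eqv v : (v *m (A + 2%:M + l%:M) == 0) = (v *m A == (- 2 - l) *: v).
  rewrite !mulmxDr !mul_mx_scalar -addrA -scalerDl addr_eq0.
  by rewrite -scaleNr opprD.
split=> [/eqP/det0P[v v0 /eqP]|/eigenvalueP[v /eqP]].
  by rewrite eqv => /eqP ?; apply/eigenvalueP; exists v.
by rewrite -eqv => /eqP ? v0; apply/eqP/det0P; exists v.
Qed.

(** [w] is [(A_H + 2 + l)^-1 1], built from the spectral decomposition so that its coordinate sum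
    can be compared with [omega]; invertibility gives the uniqueness clause. *)
Lemma resolvent_ones l : ~~ eigenvalue A (- 2 - l) ->
  exists w : V -> R,
  [/\ forall a, \sum_b (H a b)%:R * w b + (2 + l) * w a = 1,
      omega H l = 1 + l * \sum_a w a &
      forall (h : V -> R) k,
        (forall a, \sum_b (H a b)%:R * h b + (2 + l) * h a = k) ->
        forall a, h a = k * w a].
Proof.
move=> nev.
have M_unit : A + 2%:M + l%:M \in unitmx.
  by rewrite unitmxE unitfE; apply: contra nev => /eqP/det_eigenvalue.
have ev_neq a : eigenvalue A a -> a + 2 + l != 0.
  by move=> aev; apply: contraNneq nev => al; rewrite [_ - _](_ : _ = a)//; lra.
pose w : 'cV[R]_#|V| := \sum_(a <- eigenvals A) (a + 2 + l)^-1 *: P a.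
have MP a : (A + 2%:M + l%:M) *m P a = (a + 2 + l) *: P a.
  rewrite !mulmxDl !mul_scalar_mx eigenproj_eigen ?adjmx_sym//.
  by rewrite -!scalerDl.
have Mw : (A + 2%:M + l%:M) *m w = ones R #|V|.
  rewrite [RHS](eigenproj_sum adjmx_sym) mulmx_sumr; apply: eq_big_seq => a.
  rewrite mem_eigenvals => /ev_neq al.
  by rewrite -scalemxAr MP scalerA mulVf// scale1r.
have MF (v : 'cV[R]_#|V|) x : ((A + 2%:M + l%:M) *m v) (enum_rank x) 0 =
    \sum_b (H x b)%:R * v (enum_rank b) 0 + (2 + l) * v (enum_rank x) 0.
  rewrite !mulmxDl !mul_scalar_mx !mxE -addrA -mulrDl -[in RHS]sum_enum_val.
  congr (_ + _).
  by apply: eq_bigr => i _; rewrite !mxE enum_rankK enum_valK.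
exists (fun x => w (enum_rank x) 0); split.
- by move=> x; rewrite -MF Mw mxE.
- have -> : \sum_x w (enum_rank x) 0 = dotv (ones R #|V|) w.
    by rewrite -sum_enum_val; apply: eq_bigr => i _; rewrite enum_valK mxE mul1r.
  rewrite omegaE /c -addrA; congr (_ + _).
  rewrite dotv_sumr mulr_sumr.
  under [RHS]eq_bigr do rewrite dotvZr eigenproj_dot ?adjmx_sym// mulrA -/(P _).
  have wt0 a : P a = 0 -> wt a = 0 by rewrite /wt => ->; rewrite dotv0.
  have -> : \sum_(a <- main_evs) l / (a + 2 + l) * wt a =
      \sum_(a <- eigenvals A | a != -2) l / (a + 2 + l) * wt a.
    rewrite big_filter [RHS](bigID (fun a => P a == 0)) /= [X in _ = X + _]big1 ?add0r.
      by apply: eq_bigl => a; rewrite andbC.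
    by move=> a /andP[_ /eqP/wt0 ->]; rewrite mulr0.
  (* If [-2] is an eigenvalue then [l] is nonzero and its term has coefficient [l / l = 1], as in
     [omega]; otherwise the projection is 0. *)
  have [ev2|nev2] := boolP (- 2 \in eigenvals A); last first.
    rewrite /wt /P /proj_ones eigenproj_out -?mem_eigenvals ?adjmx_sym//.
    rewrite dotv0 add0r big_seq_cond [RHS]big_seq; apply: eq_bigl => a.
    by case: eqP => [->|]; rewrite ?(negPf nev2) ?andbT.
  rewrite [RHS](bigD1_seq (- 2)) ?uniq_eigenvals//=; congr (_ + _).
  have := ev_neq (- 2); rewrite -mem_eigenvals => /(_ ev2) l0.
  have e2 : - 2 + 2 + l = l by rewrite addNr add0r.
  by rewrite e2 in l0 *; rewrite divff// mul1r.
- move=> h k hk x; pose v : 'cV[R]_#|V| := \col_i h (enum_val i).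
  have vE y : v (enum_rank y) 0 = h y by rewrite mxE enum_rankK.
  have Mv : (A + 2%:M + l%:M) *m v = k *: ones R #|V|.
    apply/matrixP => i j; rewrite ord1 -(enum_valK i) MF vE mxE mxE mulr1 -[RHS](hk (enum_val i)).
    by congr (_ + _); apply: eq_bigr => b _; rewrite vE.
  rewrite -vE -[v](mulKmx M_unit) Mv -Mw -scalemxAr mulKmx// mxE//.
Qed.

(** Otherwise 1 would be an eigenvector for [-2], although [A 1] has nonnegative entries. Together
    with 0 this provides two poles. *)
Lemma main_evs_neq0 : main_evs != [::].
Proof.
apply/eqP => m0.
have P0 a : a \in eigenvals A -> a != - 2 -> P a = 0.
  move=> aev a2; apply/eqP; move: (mem_filter (fun a => (P a != 0) && (a != - 2)) a (eigenvals A)).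
  by rewrite -/main_evs m0 in_nil aev a2 !andbT => /esym/negbT/negPn.
have A1 : A *m ones R #|V| = - 2 *: ones R #|V|.
  rewrite {1}(eigenproj_sum adjmx_sym (ones R _)) {2}(eigenproj_sum adjmx_sym (ones R _)).
  rewrite mulmx_sumr scaler_sumr; apply: eq_big_seq => a aev.
  rewrite eigenproj_eigen ?adjmx_sym//; have [->//|a2] := eqVneq a (- 2).
  by have := P0 _ aev a2; rewrite /P /proj_ones => ->; rewrite !scaler0.
have /matrixP/(_ (Ordinal V_gt0) 0) := A1; rewrite !mxE => sum2.
have : 0 <= - 2 * 1 :> R by rewrite -sum2 sumr_ge0// => i _; rewrite !mxE mulr1 ler0n.
by lra.
Qed.

(** The poles of [omega H l / l]: dividing by [l] adds the pole 0, with residue [c]. *)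
Definition omega_pole_seq : seq R := 0 :: [seq - a - 2 | a <- main_evs].

Definition omega_weight p : R := if p == 0 then c else wt (- 2 - p).

Lemma omega_pole_seqP p : p \in omega_pole_seq <-> p = 0 \/ omega_poles H p.
Proof.
rewrite /omega_poles main_evsE inE; split => [/predU1P[|/mapP[a am ->]]|[->|[a am <-]]].
- by left.
- by right; exists a.
- by rewrite eqxx.
- by apply/orP; right; apply/mapP; exists a.
Qed.

Lemma omega_pole_seq_uniq : uniq omega_pole_seq.
Proof.
rewrite /= map_inj_uniq => [|a b /=]; last by lra.
rewrite filter_uniq ?uniq_eigenvals// andbT; apply/negP => /mapP[a].
rewrite mem_filter => /andP[/andP[_ /eqP a2] _] a0.
by apply: a2; lra.
Qed.

Lemma omega_weight_gt0 : {in omega_pole_seq, forall p, 0 < omega_weight p}.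
Proof.
move=> p; rewrite /omega_weight inE; have [_ _|p0 /=] := eqVneq p 0.
  by rewrite /c ltr_pwDl// dotvv_ge0.
case/mapP => a; rewrite mem_filter => /andP[/andP[Pa _] _] ->.
by rewrite [X in wt X](_ : _ = a) ?lt_def ?dotvv_eq0 ?Pa ?dotvv_ge0//; lra.
Qed.

Lemma omega_pole_sum l : l != 0 ->
  omega H l = l * pole_sum omega_weight omega_pole_seq l.
Proof.
move=> l0; rewrite omegaE /pole_sum big_cons big_map mulrDr /omega_weight eqxx.
rewrite subr0 mulrC divfK//; congr (_ + _).
rewrite mulr_sumr !big_seq; apply: eq_bigr => a.
rewrite mem_filter => /andP[/andP[_ /eqP a2] _].
have -> : (- a - 2 == 0) = false by apply/eqP => ?; apply: a2; lra.
rewrite [- 2 - (- a - 2)](_ : _ = a); last lra.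
by rewrite [l - (- a - 2)](_ : _ = a + 2 + l); [rewrite mulrAC mulrA|lra].
Qed.

Lemma omega0_gt0 : 0 < omega H 0 :> R.
Proof.
rewrite omegaE big1 => [|a _]; first by rewrite addr0 ltr_pwDl// dotvv_ge0.
by rewrite !mul0r.
Qed.

(** Off the poles [omega] and the numerator differ by nonzero factors. The point 0, a pole of
    [omega H l / l] only, is checked separately: neither vanishes there. *)
Lemma omega_neq0E (l : R) : ~ omega_poles H l ->
  (omega H l != 0) = ((pole_num omega_weight omega_pole_seq).[l] != 0).
Proof.
move=> lP; have [->|l0] := eqVneq l 0.
  rewrite gt_eqF ?omega0_gt0// pole_num_pole ?omega_pole_seq_uniq ?mem_head//.
  rewrite mulf_neq0//; first by rewrite gt_eqF// omega_weight_gt0// mem_head.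
  by rewrite prodf_seq_neq0; apply/allP => q _; apply/implyP; rewrite sub0r oppr_eq0.
have lS : l \notin omega_pole_seq.
  by apply/negP => /omega_pole_seqP[/eqP|//]; rewrite (negPf l0).
rewrite pole_num_sum ?omega_pole_seq_uniq// omega_pole_sum// !mulf_eq0.
by rewrite (negPf l0) (negPf (pole_den_neq0 lS)).
Qed.

Lemma psi_pole_ratio (l : R) : omega H l != 0 \/ omega_poles H l ->
  psi H l = (pole_den omega_pole_seq).[l] / (pole_num omega_weight omega_pole_seq).[l].
Proof.
rewrite /psi; case: asboolP => [lP _|lP [o0|//]].
  by rewrite pole_den_eq0 ?mul0r//; apply/omega_pole_seqP; right.
have [->|l0] := eqVneq l 0; first by rewrite pole_den_eq0 ?mem_head// !mul0r.
have lS : l \notin omega_pole_seq.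
  by apply/negP => /omega_pole_seqP[/eqP|//]; rewrite (negPf l0).
rewrite pole_num_sum ?omega_pole_seq_uniq// invfM mulrA divff ?pole_den_neq0//.
by rewrite omega_pole_sum// invfM mulrA divff.
Qed.

Lemma psi_star_spec :
  [/\ forall l, @lambda_star R V H < l -> ~ omega_poles H l -> omega H l != 0,
      forall y, exists2 l, @lambda_star R V H < l & psi H l = y &
      forall a b, @lambda_star R V H < a -> a < b -> psi H a < psi H b].
Proof.
(* Sorting in decreasing order exposes the two largest poles. *)
have [P1 [P2 [S [sortE P21 S_lt S_uniq]]]] : exists P1 P2 S,
    [/\ perm_eq omega_pole_seq [:: P1, P2 & S], P2 < P1,
        {in S, forall p, p < P2} & uniq S].
  have := sort_sorted (@ge_total _ R) omega_pole_seq.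
  have := perm_sort >=%R omega_pole_seq.
  have := size_sort >=%R omega_pole_seq.
  case: (sort _ _) => [|P1 [|P2 S]] /=; rewrite ?size_map //.
    by case: main_evs main_evs_neq0.
  move=> _ /permPl perm sorted; exists P1, P2, S.
  have : uniq [:: P1, P2 & S] by rewrite (perm_uniq perm) omega_pole_seq_uniq.
  rewrite /= inE negb_or => /andP[/andP[P12 _] /andP[P2S S_uniq]].
  case/andP: sorted => P21; rewrite (path_sortedE ge_trans) => /andP[/allP S_le _].
  split => //; first by rewrite perm_sym.
    by rewrite lt_neqAle eq_sym P12.
  move=> p pS; have p2 : p <= P2 := S_le p pS.
  by rewrite lt_neqAle p2 andbT; apply: contraNneq P2S => <-.
set SS := [:: P1, P2 & S] in sortE.
have W_gt0 : {in SS, forall p, 0 < omega_weight p}.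
  by move=> p; rewrite -(perm_mem sortE) => /omega_weight_gt0.
have numE l : (pole_num omega_weight omega_pole_seq).[l] = (pole_num omega_weight SS).[l].
  by rewrite !pole_numE (perm_big _ sortE); apply: eq_bigr => p _; rewrite (perm_big _ sortE).
have denE l : (pole_den omega_pole_seq).[l] = (pole_den SS).[l].
  by rewrite !pole_denE (perm_big _ sortE).
have [r [r2 r1 r0 num_gt0]] := pole_num_top_root P21 S_lt S_uniq W_gt0.
have om_neq0 l : r < l -> ~ omega_poles H l -> omega H l != 0.
  by move=> rl lP; rewrite omega_neq0E// numE gt_eqF// num_gt0.
(* [r] lies strictly between consecutive poles, so it is a true zero of [omega], and none lies above
   it. *)
have rE : @lambda_star R V H = r.
  apply: maximumE.
    have rP : ~ omega_poles H r.
      move=> rP; have : r \in omega_pole_seq by apply/omega_pole_seqP; right.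
      rewrite (perm_mem sortE) !inE (lt_eqF r1) (gt_eqF r2) /= => /S_lt.
      by move=> /lt_trans/(_ r2); rewrite ltxx.
    by split => //; apply/eqP/negPn; rewrite omega_neq0E// numE r0 eqxx.
  move=> l [lP o0]; rewrite leNgt; apply/negP => /om_neq0/(_ lP).
  by rewrite o0 eqxx.
have psiE l : r < l -> psi H l = (pole_den SS).[l] / (pole_num omega_weight SS).[l].
  move=> rl; rewrite psi_pole_ratio ?numE ?denE//.
  by have [|lP] := pselect (omega_poles H l); [right|left; exact: om_neq0].
rewrite rE; split=> // [y|a b ra ab].
  have [l rl le] := pole_ratio_surj P21 S_lt S_uniq W_gt0 r2 r1 r0 y.
  by exists l; rewrite // psiE// le mulfK// gt_eqF// num_gt0.
rewrite (psiE _ ra) (psiE _ (lt_trans ra ab)).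
exact: (pole_ratio_incr P21 S_lt S_uniq W_gt0 r2).
Qed.

End OmegaPsi.

(** * Stationary values of a corona *)

Section CoronaSpectrum.
Variables (R : realType) (V1 V2 : finType) (G : sgraph V1) (H : sgraph V2).
Hypothesis G_connected : graph_connected G.

(* Subtracting the equation at a vertex of G from those in its copy of H gives
   (A_H + 2 + l) h_x = l g(x) 1, so that the fibre sums are (omega l) g(x). *)
Lemma corona_stationary_base (l : R) :
  ~~ eigenvalue (adjmx R H) (- 2 - l) -> omega H l != 0 ->
  stationary_lambda (corona G H) l -> stationary_lambda G (l / omega H l).
Proof.
move=> nev o0 /stationary_lambdaP[f [c [eqn f1 [u fu]]]].
have [w [_ wo wuniq]] := resolvent_ones nev.
pose s := corona_fiber_sum f.
have s1 : \sum_x s x = 0 by rewrite -sum_corona_fiber.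
have hE x a : f (inr (x, a)) = l * f (inl x) * w a.
  apply: (wuniq (fun b => f (inr (x, b)))) => {}a; have := eqn (inr (x, a)); have := eqn (inl x).
  rewrite corona_dist_sum_inl// corona_dist_sum_inr//.
  by have := sum_corona f; rewrite f1; lra.
have sE x : s x = omega H l * f (inl x).
  rewrite /s /corona_fiber_sum; under eq_bigr do rewrite hE.
  by rewrite -mulr_sumr wo; ring.
apply/stationary_lambdaP; exists s, (c - \sum_y \sum_b f (inr (y, b))); split => //.
  move=> x; have := eqn (inl x); rewrite corona_dist_sum_inl// -/s.
  by move=> /(canRL (addrK _)) ->; rewrite sE mulrA divfK// addrA.
(* If all fibre sums vanish, so do the values on [G] because [omega] is nonzero, and then those on
   the copies. *)
apply: contrapT => s0; move/eqP: fu; apply.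
have g0 x : f (inl x) = 0.
  apply/eqP/negPn/negP => fx; apply: s0; exists x.
  by rewrite sE mulf_neq0.
by case: u => [x|[x a]]; rewrite ?hE g0 // mulr0 mul0r.
Qed.

(** Converse construction: from [s] on [G] put [g = s / omega] and [h_x = l g(x) w]; the fibre sums
    are then [s] again. *)
Lemma base_stationary_corona (l y : R) :
  ~~ eigenvalue (adjmx R H) (- 2 - l) -> omega H l != 0 -> l = y * omega H l ->
  stationary_lambda G y -> stationary_lambda (corona G H) l.
Proof.
move=> nev o0 ly /stationary_lambdaP[s [c [eqn s1 [x sx]]]].
have [w [weq wo _]] := resolvent_ones nev.
pose f (u : V1 + V1 * V2) : R := match u with
  | inl x => s x / omega H l | inr (x, a) => l * (s x / omega H l) * w a end.
have fs z : corona_fiber_sum f z = s z.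
  rewrite /corona_fiber_sum /= -mulr_sumr -[RHS](divfK o0) {4}wo.
  by ring.
have f1 : \sum_u f u = 0.
  by rewrite sum_corona_fiber -[RHS]s1; apply: eq_bigr => z _; rewrite fs.
apply/stationary_lambdaP; exists f, (c + \sum_z \sum_b f (inr (z, b))); split=> //.
  have sumE z : \sum_v (dist G z v)%:R * corona_fiber_sum f v = l * (s z / omega H l) + c.
    under eq_bigr do rewrite fs.
    by rewrite eqn; congr (_ + _); rewrite {1}ly; field.
  case=> [z|[z a]]; first by rewrite corona_dist_sum_inl// sumE addrA.
  rewrite corona_dist_sum_inr// sumE.
  have := sum_corona f; rewrite f1.
  have := weq a => /(congr1 (fun t => l * (s z / omega H l) * t)).
  rewrite mulrDr mulr_sumr mulr1 => wa.
  have -> : \sum_b (H a b)%:R * f (inr (z, b)) =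
      \sum_b l * (s z / omega H l) * ((H a b)%:R * w b).
    by apply: eq_bigr => b _; rewrite /=; ring.
  move: wa; rewrite [f (inr (z, a))]/=; lra.
by exists (inl x); rewrite /= mulf_neq0 ?invr_eq0.
Qed.

End CoronaSpectrum.

(** * The largest stationary value of the corona *)

Lemma maximum_finite (R : realType) (A : set R) (s : seq R) :
  (forall x, A x -> x \in s) -> (A !=set0)%classic ->
  A (maximum A) /\ ubound A (maximum A).
Proof.
move=> As [x0 Ax0].
pose t := [seq x <- s | `[< A x >]].
have tP x : x \in t <-> A x.
  rewrite mem_filter; split=> [/andP[/asboolP//]|Ax].
  by rewrite As// andbT; apply/asboolP.
have t0 : x0 \in t by apply/tP.
have [m mt mmax] : exists2 m, m \in t & {in t, forall x, x <= m}.
  elim: (t) (x0) t0 => // y u IH _ _; case: u IH => [_|z u IH].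
    by exists y; rewrite ?mem_head// => x; rewrite inE => /eqP ->.
  have [|m mu mmax] := IH z; first exact: mem_head.
  exists (Order.max y m) => [|x].
    by rewrite maxEle; case: ifP; rewrite ?mem_head// inE mu orbT.
  rewrite inE le_max => /predU1P[->|/mmax ->]; first by rewrite lexx.
  by rewrite orbT.
have ubm : ubound A m by move=> x /tP/mmax.
have Am : A m by apply/tP.
by rewrite (maximumE Am ubm).
Qed.

Theorem proposition4p7 (R : realType) (V1 V2 : finType)
    (G : sgraph V1) (H : sgraph V2)
    (G_connected : graph_connected G) (V1_ge2 : (2 <= #|V1|)%N)
    (V2_ge1 : (1 <= #|V2|)%N)
    (not_ev : ~~ eigenvalue (adjmx R H) (- 2 - psi_star_inv H (QEC R G))) :
  (QEC R (corona G H))%:E =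
  Order.max (psi_star_inv H (QEC R G))%:E (gamma3 R G H).
Proof.
have [omega_neq0 psi_surj psi_incr] := psi_star_spec R H V2_ge1.
have not_pole (l : R) : ~~ eigenvalue (adjmx R H) (- 2 - l) -> ~ omega_poles H l.
  move=> /negP nev [a [[aev _] _] al]; apply: nev.
  by rewrite [- 2 - l](_ : _ = a)//; move: al; lra.
have psiE l : ~~ eigenvalue (adjmx R H) (- 2 - l) -> psi H l = l / omega H l.
  by move=> /not_pole lP; rewrite /psi; case: asboolP.
have [stG leG] := QEC_stationary R G V1_ge2.
have W2 : (2 <= #|{: V1 + V1 * V2}|)%N.
  by rewrite card_sum; apply: leq_trans (leq_addr _ _).
have [stC leC] := QEC_stationary R (corona G H) W2.
set L := psi_star_inv H (QEC R G) in not_ev *; set q := QEC R (corona G H) in stC leC *.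
have [L_gt psiL] : lambda_star R H < L /\ psi H L = QEC R G.
  (* Surjectivity of [psi] excludes the default value of [xget]. *)
  rewrite /L /psi_star_inv; case: xgetP => [l -> []//|none].
  by have [l l1 l2] := psi_surj (QEC R G); case: (none l).
have oL := omega_neq0 _ L_gt (not_pole _ not_ev).
have Lq : L <= q.
  apply: leC; apply: (base_stationary_corona G_connected not_ev oL _ stG).
  by rewrite -psiL psiE// divfK.
(* If [q > L] were outside the singular values, [psi q] would be stationary for [G] and exceed
   [psi L = QEC(G)]. *)
have qL : ~~ eigenvalue (adjmx R H) (- 2 - q) -> q = L.
  move=> nev; apply/eqP; rewrite eq_le Lq andbT leNgt; apply/negP => Lq'.
  have q_gt := lt_trans L_gt Lq'.
  have oq := omega_neq0 _ q_gt (not_pole _ nev).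
  have := leG _ (corona_stationary_base G_connected nev oq stC).
  by rewrite -psiE// -psiL leNgt psi_incr.
rewrite /gamma3 /maximum_ninfty.
set T := (_ `&` _)%classic; case: asboolP => [T0|T0].
  rewrite qL ?maxeNy//; apply/negP => /det_eigenvalue ev.
  by have : T q by []; rewrite T0.
(* [T] sits inside the finite set of values [-2 - a] with [a] an eigenvalue, so its maximum is
   attained. *)
have [[Tst _] Tub] : T (maximum T) /\ ubound T (maximum T).
  apply: (@maximum_finite _ _ [seq - 2 - a | a <- eigenvals (adjmx R H)]).
    move=> l [_ /det_eigenvalue ev]; apply/mapP; exists (- 2 - l).
      by rewrite mem_eigenvals.
    by lra.
  by apply/set0P/eqP.
have gq := leC _ Tst.
rewrite -EFin_max; congr (_%:E); apply/eqP; rewrite eq_le ge_max Lq gq andbT le_max.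
(* Either [q] belongs to [T], hence is at most its maximum, or [q = L]. *)
have [ev|/qL ->] := boolP (eigenvalue (adjmx R H) (- 2 - q)); last by rewrite lexx.
by rewrite Tub ?orbT//; split => //; apply/det_eigenvalue.
Qed.
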